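(* For all integers $n\geq 1$ and $3\leq m\leq n+1$, one has $B_{n+1,m}=2\kappa_{n,m}$. Consequently, for all $n\ge 1$, $B_{n+1}=2^n+2\kappa_n$.
   Context: For a positive integer $N$, a collection $\Phi\subseteq 2^{[N]}$ is balanced if there exist positive real weights $(\lambda_S)_{S\in\Phi}$ with $\sum_{S\in\Phi}\lambda_S\mathbf{1}_S=(1,\dots,1)^{\mathsf T}\in\mathbb{R}^N$, where $\mathbf{1}_S$ is the characteristic vector of $S$. A balanced collection is minimal if none of its proper subcollections is balanced. $B_{N,m}$ is the number of minimal balanced collections on $[N]$ consisting of exactly $m$ subsets, and $B_N$ is the total number of minimal balanced collections on $[N]$. The resonance arrangement is $\mathcal{A}_n:=\{H_S:\varnothing\ne S\subseteq[n]\}$ with $H_S:=\{x\in\mathbb{R}^n:\sum_{j\in S}x_j=0\}$; the hyperplane $H_S$ is associated with its normal vector $\mathbf{1}_S$, so the normals are precisely the nonzero vectors of $\{0,1\}^n$. A circuit of $\mathcal{A}_n$ is an inclusion-minimal linearly dependent (over $\mathbb{R}$) set of these normal vectors. $\kappa_{n,m}$ is the number of $m$-element circuits of $\mathcal{A}_n$, and $\kappa_n$ is the total number of circuits of $\mathcal{A}_n$. *)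

(* Defs.v *)
From mathcomp Require Import all_boot all_order all_algebra.
From mathcomp Require Import boolp reals.

Set Implicit Arguments.
Unset Strict Implicit.
Unset Printing Implicit Defensive.

Import Order.TTheory GRing.Theory Num.Theory.

Local Open Scope ring_scope.

(* [N] is represented by 'I_N = {0, ..., N-1}. *)

Definition char_vec (R : realType) (N : nat) (S : {set 'I_N}) : 'cV[R]_N :=
  \col_i (i \in S)%:R.

(* Only the values of lam on Phi matter, so a total function on subsets stands
   for the family of weights indexed by Phi. *)
Definition balanced (R : realType) (N : nat) (Phi : {set {set 'I_N}}) : Prop :=
  exists lam : {set 'I_N} -> R,
    (forall S, S \in Phi -> 0 < lam S) /\
    \sum_(S in Phi) lam S *: char_vec R S = const_mx 1.

Definition minimal_balanced (R : realType) (N : nat)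
    (Phi : {set {set 'I_N}}) : bool :=
  minset (fun Psi : {set {set 'I_N}} => `[< balanced R Psi >]) Phi.

Definition num_minimal_balanced_size (R : realType) (N m : nat) : nat :=
  #|[set Phi : {set {set 'I_N}} | minimal_balanced R Phi & #|Phi| == m]|.

Definition num_minimal_balanced (R : realType) (N : nat) : nat :=
  #|[set Phi : {set {set 'I_N}} | minimal_balanced R Phi]|.

(* The hyperplane H_S of the resonance arrangement has normal vector
   char_vec R S. As char_vec R is injective, a set of normal vectors is
   represented by the set of its indices S, all of them nonempty. *)
Definition resonance_indices (n : nat) : {set {set 'I_n}} :=
  [set A | A != set0].

Definition lin_dependent (R : realType) (n : nat)
    (C : {set {set 'I_n}}) : bool :=
  ~~ free [seq char_vec R A | A <- enum C].

Definition resonance_circuit (R : realType) (n : nat)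
    (C : {set {set 'I_n}}) : bool :=
  (C \subset resonance_indices n) && minset (@lin_dependent R n) C.

Definition num_circuits_size (R : realType) (n m : nat) : nat :=
  #|[set C : {set {set 'I_n}} | resonance_circuit R C & #|C| == m]|.

Definition num_circuits (R : realType) (n : nat) : nat :=
  #|[set C : {set {set 'I_n}} | resonance_circuit R C]|.

(* Main.v *)
(** Single out one element of the ground set and replace every member of a
    collection that contains it by its complement.  A covering
    [sum lam_S 1_S = 1] then becomes a linear relation between characteristic
    vectors on the remaining [n] elements, in which the complemented members
    carry negative coefficients.  A minimal balanced collection with at least
    three members thus becomes a circuit; conversely the relation of a circuit
    is unique up to a scalar, and its two possible signs recover exactly two
    minimal balanced collections.  The others are the [2 ^ n] complementary
    pairs (with [set0] removed). *)

Require Import Defs.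
From mathcomp Require Import all_boot all_order all_algebra.
From mathcomp Require Import boolp reals.
From mathcomp Require Import lra.

Set Implicit Arguments.
Unset Strict Implicit.
Unset Printing Implicit Defensive.

Import Order.TTheory GRing.Theory Num.Theory.

Local Open Scope ring_scope.

(** * Auxiliary facts on sums and injective maps *)

Lemma big_setIsub (V : nmodType) (I : finType) (A B : {set I}) (F : I -> V) :
  B \subset A -> \sum_(i in A) (if i \in B then F i else 0) = \sum_(i in B) F i.
Proof.
move=> sBA; rewrite -big_mkcondr /=; apply: eq_bigl => i.
by case: (boolP (i \in B)) => [/(subsetP sBA) ->|]; rewrite ?andbF.
Qed.

(** Serves to transport weights along [fold], which is injective only on suitable collections; [t0]
    fills the values off the image. *)
Lemma inj_in_section (I J : finType) (T : Type) (t0 : T) (A : {set I})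
    (f : I -> J) (h : I -> T) :
  {in A &, injective f} -> exists g : J -> T, {in A, forall i, g (f i) = h i}.
Proof.
move=> f_inj.
exists (fun j => if [pick i in A | f i == j] is Some i then h i else t0).
move=> i Ai; case: pickP => [k /andP[Ak /eqP fk]|/(_ i)].
  by rewrite (f_inj _ _ Ak Ai fk).
by rewrite Ai eqxx.
Qed.

(** * Minimal balanced collections and uniqueness of their weights *)

Section MinimalBalanced.
Variables (R : realType) (N : nat).
Implicit Types (Phi Psi : {set {set 'I_N}}) (lam mu : {set 'I_N} -> R).

Definition cover_weight Phi lam (i : 'I_N) : R :=
  \sum_(S in Phi) lam S * (i \in S)%:R.

Lemma balancedP Phi :
  balanced R Phi <->
  exists2 lam, {in Phi, forall S, 0 < lam S} &
               forall i, cover_weight Phi lam i = 1.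
Proof.
split=> [[lam [pos eq1]]|[lam pos eq1]]; exists lam => //.
  move=> i; move/matrixP/(_ i ord0): eq1; rewrite summxE mxE => <-.
  by apply: eq_bigr => S _; rewrite !mxE.
split=> //; apply/matrixP=> i j; rewrite summxE mxE -(eq1 i).
by apply: eq_bigr => S _; rewrite !mxE.
Qed.

Lemma minimal_balancedP Phi :
  reflect (balanced R Phi /\
           forall Psi, balanced R Psi -> Psi \subset Phi -> Psi = Phi)
          (minimal_balanced R Phi).
Proof.
apply: (iffP minsetP) => -[/asboolP bal min]; split=> //.
  by move=> Psi /asboolP; apply: min.
by move=> Psi /asboolP; apply: min.
Qed.

Lemma balanced_cover Phi (i : 'I_N) :
  balanced R Phi -> exists2 S, S \in Phi & i \in S.
Proof.
case/balancedP=> lam _ /(_ i) eq1; apply/exists_inP; apply: contraT.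
rewrite negb_exists_in => /forall_inP niS.
move: eq1; rewrite /cover_weight big1 => [/eqP|S /niS/negbTE ->]; last first.
  by rewrite mulr0.
by rewrite eq_sym oner_eq0.
Qed.

Lemma balanced_support Phi (nu : {set 'I_N} -> R) (k : R) :
  {in Phi, forall S, 0 <= nu S} -> 0 < k ->
  (forall i, cover_weight Phi nu i = k) -> balanced R [set S in Phi | 0 < nu S].
Proof.
move=> nu_ge0 k_gt0 eqk; apply/balancedP; exists (fun S => nu S / k).
  by move=> S; rewrite inE => /andP[_ nu_gt0]; rewrite divr_gt0.
move=> i; transitivity (cover_weight Phi nu i / k); last first.
  by rewrite eqk divff ?lt0r_neq0.
rewrite /cover_weight mulr_suml -(@big_setIsub _ _ Phi); last first.
  by apply/subsetP=> S; rewrite inE => /andP[].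
apply: eq_bigr => S PhiS; rewrite inE PhiS mulrAC /=.
have [//|nu_le0] := ltP 0 (nu S).
by rewrite (_ : nu S = 0) ?mul0r//; apply/le_anti; rewrite nu_le0 nu_ge0.
Qed.

Lemma minimal_balanced_set0 Phi :
  (0 < N)%N -> minimal_balanced R Phi -> set0 \notin Phi.
Proof.
move=> N_gt0 /minimal_balancedP[/balancedP[lam pos eq1] min].
apply/negP=> Phi0; have: balanced R (Phi :\ set0).
  apply/balancedP; exists lam => [S /setD1P[_ /pos]//|i].
  rewrite -(eq1 i) /cover_weight [in RHS](big_setD1 set0) //= inE mulr0.
  by rewrite add0r.
by move/min/(_ (subsetDl _ _))/setP/(_ set0); rewrite Phi0 !inE eqxx.
Qed.

(* With [s] the largest ratio [mu S / lam S], the weights [s * lam - mu] are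
   nonnegative and cover evenly, but vanish at some member of [Phi]: by
   minimality they vanish everywhere. *)
Lemma minimal_balanced_weights_unique Phi lam mu k :
  (0 < N)%N -> minimal_balanced R Phi ->
  {in Phi, forall S, 0 < lam S} -> (forall i, cover_weight Phi lam i = 1) ->
  (forall i, cover_weight Phi mu i = k) ->
  exists s, {in Phi, forall S, mu S = s * lam S}.
Proof.
move=> N_gt0 mbPhi pos eq1 eqk.
have Phi0 := minimal_balanced_set0 N_gt0 mbPhi.
have [bal min] := minimal_balancedP _ mbPhi.
have [S1 PhiS1 _] := balanced_cover (Ordinal N_gt0) bal.
pose ratio S := mu S / lam S.
case: (arg_maxP ratio PhiS1) => S0 PS0 max; set s := ratio S0 in max.
have PhiS0 : S0 \in Phi by exact: PS0.
pose nu S := s * lam S - mu S.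
have nu_ge0 : {in Phi, forall S, 0 <= nu S}.
  move=> S PhiS; rewrite subr_ge0 -ler_pdivrMr ?pos//; exact: max.
have nuE i : cover_weight Phi nu i = s - k.
  rewrite -(eqk i) -[s]mulr1 -(eq1 i) /cover_weight mulr_sumr -sumrB.
  by apply: eq_bigr => S _; rewrite mulrBl mulrA.
exists s => S PhiS; apply/eqP; rewrite eq_sym -subr_eq0 -/(nu S).
(* If [s - k] is positive, [nu] normalises to balance its support, which misses [S0] because
   [nu S0 = 0]; this contradicts minimality. *)
have [k_gt0|] := ltP 0 (s - k).
  have := min _ (balanced_support nu_ge0 k_gt0 nuE).
  have sub : [set S in Phi | 0 < nu S] \subset Phi.
    by apply/subsetP=> T; rewrite inE => /andP[].
  move/(_ sub)/setP/(_ S0); rewrite inE PhiS0 /nu /s /ratio divfK ?subrr ?ltxx//.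
  by rewrite gt_eqF ?pos.
(* Otherwise nonnegative terms have a nonpositive sum, so all vanish; at a point [i] of [S], the
   term of [S] is [nu S] itself. *)
have [i Si] : exists i, i \in S.
  by apply/set0Pn; apply: contraNneq Phi0 => <-.
rewrite -(nuE i) => le0.
have /eqP : cover_weight Phi nu i == 0.
  by rewrite eq_le le0 sumr_ge0// => T PhiT; rewrite mulr_ge0 ?nu_ge0 ?ler0n.
move/psumr_eq0P => /(_ _ S PhiS); rewrite Si mulr1 => -> // T PhiT.
by rewrite mulr_ge0 ?nu_ge0 ?ler0n.
Qed.

End MinimalBalanced.

(** * Circuits and their linear relations *)

Section Circuits.
Variables (R : realType) (n : nat).
Implicit Types (C : {set {set 'I_n}}) (c d : {set 'I_n} -> R).

Definition linear_relation C c : Prop :=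
  forall j : 'I_n, \sum_(A in C) c A * (j \in A)%:R = 0.

(** Trades coefficients indexed by positions in [enum C] for coefficients indexed by the sets
    themselves. *)
Lemma lin_dependentP C :
  reflect (exists2 c, linear_relation C c & exists2 A, A \in C & c A != 0)
          (lin_dependent R C).
Proof.
rewrite /lin_dependent; set X := [seq _ | _ <- _].
have szX : size X = #|C| by rewrite size_map cardE.
have relE c : linear_relation C c <->
    \sum_(i < size X) c (nth set0 (enum C) i) *: X`_i = 0.
  have -> : \sum_(i < size X) c (nth set0 (enum C) i) *: X`_i =
            \sum_(A in C) c A *: char_vec R A.
    rewrite -[RHS]big_enum [RHS](big_nth set0) big_mkord szX cardE.
    by apply: eq_bigr => i _; rewrite (nth_map set0).
  split=> [rel|/matrixP rel j].
    apply/matrixP=> i j; rewrite summxE mxE -[RHS](rel i).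
    by apply: eq_bigr => A _; rewrite !mxE.
  have := rel j ord0; rewrite summxE mxE => relj; rewrite -[RHS]relj.
  by apply: eq_bigr => A _; rewrite !mxE.
apply: (iffP idP) => [nfree|[c rel [A CA cA]]].
  apply: contrapT => nrel; move/negP: nfree; apply.
  apply/(@freeP _ _ _ (in_tuple X)) => k sum0 i; apply: contrapT => /eqP ki.
  pose c A := if insub (index A (enum C)) is Some l then k l else 0.
  have cE (l : 'I_(size X)) : c (nth set0 (enum C) l) = k l.
    by rewrite /c index_uniq ?enum_uniq -?cardE -?szX// valK.
  apply: nrel; exists c.
    by apply/relE; rewrite -[RHS]sum0; apply: eq_bigr => l _; rewrite cE.
  exists (nth set0 (enum C) i); last by rewrite cE.
  by rewrite -mem_enum mem_nth -?cardE -?szX.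
apply/negP=> /(@freeP _ _ _ (in_tuple X)) /(_ (fun i => c (nth set0 (enum C) i))).
move/relE: rel => /[swap] /[apply].
have lt_A : (index A (enum C) < size X)%N.
  by rewrite szX cardE index_mem mem_enum.
move/(_ (Ordinal lt_A)); rewrite /= nth_index ?mem_enum// => /eqP.
by rewrite (negbTE cA).
Qed.

Lemma circuit_relation C :
  resonance_circuit R C ->
  exists2 c, linear_relation C c & exists2 A, A \in C & c A != 0.
Proof. by case/andP=> _ /minsetP[/lin_dependentP]. Qed.

(** Otherwise [c] would be a nontrivial relation on the proper subset [C :\ A]. *)
Lemma circuit_relation_eq0 C c A :
  resonance_circuit R C -> linear_relation C c -> A \in C -> c A = 0 ->
  {in C, forall B, c B = 0}.
Proof.
case/andP=> _ /minsetP[_ min] rel CA cA B CB; apply: contrapT => /eqP cB.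
have : lin_dependent R (C :\ A).
  apply/lin_dependentP; exists c.
    by move=> j; rewrite -[RHS](rel j) [in RHS](big_setD1 A)//= cA mul0r add0r.
  by exists B => //; rewrite !inE CB andbT; apply: contraNneq cB => ->; rewrite cA.
by move/min/(_ (subsetDl _ _))/setP/(_ A); rewrite CA !inE eqxx.
Qed.

Lemma circuit_relation_nonzero C :
  resonance_circuit R C ->
  exists2 c, linear_relation C c & {in C, forall A, c A != 0}.
Proof.
move=> circ; have [c rel [B CB cB]] := circuit_relation circ.
exists c => // A CA; apply: contraNneq cB => cA.
by rewrite (circuit_relation_eq0 circ rel CA cA).
Qed.

(** Subtracting the multiple of [c] that agrees with [d] at one member leaves a relation with a zero
    coefficient, hence zero on [C]. *)
Lemma circuit_relation_unique C c d :
  resonance_circuit R C -> linear_relation C c ->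
  {in C, forall A, c A != 0} -> linear_relation C d ->
  exists s, {in C, forall A, d A = s * c A}.
Proof.
move=> circ relc c_neq0 reld; have [? _ [A CA _]] := circuit_relation circ.
pose s := d A / c A; exists s => B CB.
apply/eqP; rewrite -subr_eq0; apply/eqP.
apply: (@circuit_relation_eq0 C (fun B => d B - s * c B) A) => //.
  move=> j; have : \sum_(B in C) d B * (j \in B)%:R -
      s * \sum_(B in C) c B * (j \in B)%:R = 0.
    by rewrite reld relc mulr0 subr0.
  rewrite mulr_sumr -sumrB => sum0; rewrite -[RHS]sum0.
  by apply: eq_bigr => D _; rewrite mulrBl mulrA.
by rewrite /s divfK ?subrr ?c_neq0.
Qed.

(** A two-term relation with nonzero coefficients forces both sets to have the same points, and a
    one-term relation fails at any point of its nonempty set. *)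
Lemma circuit_card_ge3 C : resonance_circuit R C -> (3 <= #|C|)%N.
Proof.
move=> circ; have [c rel c_neq0] := circuit_relation_nonzero circ.
have C_nz A : A \in C -> exists j, j \in A.
  case/andP: circ => /subsetP sub _ /sub; rewrite inE.
  by move/set0Pn.
rewrite leqNgt; apply/negP; rewrite ltnS leq_eqVlt ltnS leq_eqVlt ltnS leqn0.
case/or3P.
- case/cards2P=> A [B [neqAB defC]]; case/negP: (neqAB).
  have relAB j : c A * (j \in A)%:R + c B * (j \in B)%:R = 0.
    by rewrite -[RHS](rel j) defC big_setU1 ?in_set1//= big_set1.
  have cA : c A != 0 by rewrite c_neq0// defC !inE eqxx.
  have cB : c B != 0 by rewrite c_neq0// defC !inE eqxx orbT.
  apply/eqP/setP=> j; have := relAB j.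
  case: (j \in A) (j \in B) => [] [] //; rewrite ?mulr0 ?mulr1 ?addr0 ?add0r.
    by move/eqP; rewrite (negbTE cA).
  by move/eqP; rewrite (negbTE cB).
- case/cards1P=> A defC; have CA : A \in C by rewrite defC inE.
  have [j Aj] := C_nz _ CA; move: (rel j).
  by rewrite defC big_set1 Aj mulr1 => /eqP; rewrite (negbTE (c_neq0 _ CA)).
- rewrite cards_eq0 => /eqP C0.
  by have [? _ [A]] := circuit_relation circ; rewrite C0 inE.
Qed.

End Circuits.

(** * Folding subsets of [n + 1] points onto [n] points *)

Section Folding.
Variable n : nat.
Implicit Types (A : {set 'I_n}) (S : {set 'I_n.+1}).

(* [fold S] is whichever of [S] and its complement avoids the element [ord0];
   [unfold b A] is [A] if [b], the complement of [A] otherwise. *)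
Definition fold S : {set 'I_n} :=
  [set j | (lift ord0 j \in S) (+) (ord0 \in S)].

Definition unfold (b : bool) A : {set 'I_n.+1} :=
  [set i | (if unlift ord0 i is Some j then j \in A else false) (+) ~~ b].

Lemma unfold0 b A : (ord0 \in unfold b A) = ~~ b.
Proof. by rewrite inE unlift_none. Qed.

Lemma unfold_lift b A j : (lift ord0 j \in unfold b A) = (j \in A) (+) ~~ b.
Proof. by rewrite inE liftK. Qed.

Lemma unfoldK b A : fold (unfold b A) = A.
Proof.
apply/setP=> j; rewrite inE unfold0 unfold_lift.
by rewrite -addbA addbb addbF.
Qed.

Lemma foldK S : unfold (ord0 \notin S) (fold S) = S.
Proof.
apply/setP=> i; case: (unliftP ord0 i) => [j|] ->; last first.
  by rewrite unfold0 negbK.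
by rewrite unfold_lift inE negbK -addbA addbb addbF.
Qed.

Lemma unfoldN b A : unfold (~~ b) A = ~: unfold b A.
Proof.
by apply/setP=> i; rewrite !inE negbK; case: b;
  rewrite ?addbT ?addbF ?negbK.
Qed.

Lemma fold_eq S T : fold S = fold T -> T = S \/ T = ~: S.
Proof.
move=> eqST; rewrite -(foldK S) -(foldK T) eqST -unfoldN.
by case: (ord0 \in S) (ord0 \in T) => [] []; auto.
Qed.

(** * Complementary pairs *)

(** For [A = set0] only the full set remains, so the one-member balanced collection is included. *)
Definition complementary_pair A : {set {set 'I_n.+1}} :=
  [set unfold b A | b : bool] :\ set0.

Lemma complementary_pairP A S :
  reflect (S != set0 /\ fold S = A) (S \in complementary_pair A).
Proof.
rewrite 2!inE; apply: (iffP andP) => -[S0].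
  by case/imsetP=> b _ defS; split=> //; rewrite defS unfoldK.
by move=> <-; split=> //; apply/imsetP; exists (ord0 \notin S); rewrite ?foldK.
Qed.

Lemma complementary_pair_inj : injective complementary_pair.
Proof.
move=> A B eqAB; have: unfold false A \in complementary_pair A.
  apply/complementary_pairP; rewrite unfoldK; split=> //.
  by apply/set0Pn; exists ord0; rewrite unfold0.
by rewrite eqAB => /complementary_pairP[_]; rewrite unfoldK.
Qed.

Lemma card_complementary_pair A : (#|complementary_pair A| <= 2)%N.
Proof.
apply: leq_trans (subset_leq_card (subsetDl _ _)) _.
by apply: leq_trans (leq_imset_card _ _) _; rewrite card_bool.
Qed.

(** * Cover weights as signed linear relations *)

Section Weights.
Variable R : realType.
Implicit Types (Phi Psi : {set {set 'I_n.+1}}) (C : {set {set 'I_n}}).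
Implicit Types (lam mu : {set 'I_n.+1} -> R) (c : {set 'I_n} -> R).

Definition fold_sign S : R := (-1) ^+ (ord0 \in S).

Lemma fold_sign_neq0 S : fold_sign S != 0.
Proof. by rewrite signr_eq0. Qed.

Lemma fold_signK S : fold_sign S * fold_sign S = 1.
Proof. by rewrite -expr2 sqrr_sign. Qed.

(** Termwise, the indicator of [S] at [lift ord0 j] minus that at [ord0] is [fold_sign S] times the
    indicator of [fold S] at [j]. *)
Lemma fold_cover Phi mu (j : 'I_n) :
  \sum_(S in Phi) fold_sign S * mu S * (j \in fold S)%:R =
  cover_weight Phi mu (lift ord0 j) - cover_weight Phi mu ord0.
Proof.
rewrite -sumrB; apply: eq_bigr => S _; rewrite /fold_sign inE.
case: (ord0 \in S) (lift ord0 j \in S) => [] [] /=;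
  by rewrite ?expr0 ?expr1 ?mulN1r ?mul1r ?mulr0 ?mulr1 ?subr0 ?subrr ?sub0r.
Qed.

(** The dictionary between the two sides: by [fold_cover], the relation says that every point is
    covered as much as [ord0]. *)
Lemma linear_relation_fold Phi c mu :
  {in Phi &, injective fold} ->
  {in Phi, forall S, c (fold S) = fold_sign S * mu S} ->
  linear_relation (fold @: Phi) c <->
  forall i, cover_weight Phi mu i = cover_weight Phi mu ord0.
Proof.
move=> inj cE.
have sumE j : \sum_(A in fold @: Phi) c A * (j \in A)%:R =
    cover_weight Phi mu (lift ord0 j) - cover_weight Phi mu ord0.
  rewrite big_imset// -fold_cover; apply: eq_bigr => S PhiS.
  by rewrite cE.
split=> [rel i|eq0 j]; last by rewrite sumE eq0 subrr.
case: (unliftP ord0 i) => [j|] -> //.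
by apply/eqP; rewrite -subr_eq0 -sumE rel.
Qed.

Lemma balanced_complementary_pair A : balanced R (complementary_pair A).
Proof.
apply/balancedP; exists (fun=> 1) => [S _|i]; first exact: ltr01.
have [b ib] : exists b, i \in unfold b A.
  case: (boolP (i \in unfold true A)) => iA; first by exists true.
  by exists false; rewrite -[false]/(~~ true) unfoldN inE.
rewrite /cover_weight (big_setD1 (unfold b A)) /=; last first.
  apply/complementary_pairP; rewrite unfoldK; split=> //.
  by apply/set0Pn; exists i.
rewrite ib mulr1 big1 ?addr0// => T; rewrite !in_setD1 => /and3P[neqT _].
case/imsetP=> b' _ defT; have defb' : b' = ~~ b.
  by move: neqT; rewrite defT; case: (b') (b) => [] []; rewrite ?eqxx.
by rewrite defT defb' unfoldN inE ib mulr0.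
Qed.

(** A point of one member is missed by the other, so a balanced subcollection must keep both. *)
Lemma minimal_balanced_complementary_pair A :
  minimal_balanced R (complementary_pair A).
Proof.
apply/minimal_balancedP; split=> [|Psi bal sub].
  exact: balanced_complementary_pair.
apply/eqP; rewrite eqEsubset sub; apply/subsetP=> S /complementary_pairP[S0 SA].
have [i Si] := set0Pn _ S0; have [T PsiT Ti] := balanced_cover i bal.
have /complementary_pairP[_ TA] := subsetP sub _ PsiT.
have [<- //|defT] := fold_eq (etrans SA (esym TA)).
by move: Ti; rewrite defT inE Si.
Qed.

Lemma minimal_balanced_sub_pair Phi A :
  minimal_balanced R Phi -> complementary_pair A \subset Phi ->
  Phi = complementary_pair A.
Proof.
by case/minimal_balancedP=> _ min /(min _ (balanced_complementary_pair A)).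
Qed.

Lemma minimal_balanced_card_le2 Phi :
  minimal_balanced R Phi -> (#|Phi| <= 2)%N ->
  exists A, Phi = complementary_pair A.
Proof.
move=> mbPhi card_le2; have [bal _] := minimal_balancedP _ _ mbPhi.
have [lam pos eq1] := (balancedP _ _).1 bal.
have [S PhiS S0] := balanced_cover ord0 bal.
exists (fold S); apply: minimal_balanced_sub_pair => //.
apply/subsetP=> T /complementary_pairP[/set0Pn[i Ti]] eqTS.
have [-> //|defT] := fold_eq (esym eqTS).
have Si : i \notin S by move: Ti; rewrite defT inE.
have [U PhiU Ui] := balanced_cover i bal.
have neqSU : S != U by apply: contraNneq Si => ->.
have defPhi : Phi = [set S; U].
  apply/esym/eqP; rewrite eqEcard cards2 neqSU card_le2 andbT.
  by apply/subsetP=> V; rewrite !inE => /orP[] /eqP ->.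
have sumE k : lam S * (k \in S)%:R + lam U * (k \in U)%:R = 1.
  by rewrite -[RHS](eq1 k) /cover_weight defPhi big_setU1 ?in_set1//= big_set1.
suff -> : T = U by [].
(* At [i], outside [S], only [U] counts, so [lam U = 1]; as [lam S] is positive, [U] must be the
   complement of [S]. *)
have lamS := pos _ PhiS; have := sumE i.
rewrite defT (negbTE Si) Ui mulr0 mulr1 add0r => lamU.
apply/setP=> k; have := sumE k; rewrite inE lamU mul1r.
by case: (k \in S) (k \in U) => [] [] //=; lra.
Qed.

Lemma card_small_minimal_balanced :
  #|[set Phi : {set {set 'I_n.+1}} | minimal_balanced R Phi & (#|Phi| <= 2)%N]|
  = (2 ^ n)%N.
Proof.
have -> : [set Phi : {set {set 'I_n.+1}} |
             minimal_balanced R Phi & (#|Phi| <= 2)%N]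
          = [set complementary_pair A | A : {set 'I_n}].
  apply/setP=> Phi; rewrite inE; apply/andP/imsetP.
    by case=> mb /(minimal_balanced_card_le2 mb)[A ->]; exists A.
  case=> A _ ->; split; first exact: minimal_balanced_complementary_pair.
  exact: card_complementary_pair.
rewrite card_imset; last exact: complementary_pair_inj.
by rewrite -cardsT -powersetT card_powerset cardsT card_ord.
Qed.

(** * From minimal balanced collections with at least three members to circuits *)

Section Large.
Variable Phi : {set {set 'I_n.+1}}.
Hypotheses (mbPhi : minimal_balanced R Phi) (card_ge3 : (3 <= #|Phi|)%N).

Lemma large_not_sub_pair A : ~ complementary_pair A \subset Phi.
Proof.
move=> /(minimal_balanced_sub_pair mbPhi) defPhi; move: card_ge3.
by rewrite defPhi ltnNge card_complementary_pair.
Qed.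

(** Distinct members with equal folds would be complementary and put a whole pair inside [Phi]. *)
Lemma fold_inj_large : {in Phi &, injective fold}.
Proof.
move=> S T PhiS PhiT eqST; have [-> //|defT] := fold_eq eqST.
case: (@large_not_sub_pair (fold S)); apply/subsetP=> U.
case/complementary_pairP=> _ /esym/fold_eq[-> //|->].
by rewrite -defT.
Qed.

Lemma large_relation c lam :
  {in Phi, forall S, 0 < lam S} -> (forall i, cover_weight Phi lam i = 1) ->
  {in Phi, forall S, c (fold S) = fold_sign S * lam S} ->
  linear_relation (fold @: Phi) c.
Proof.
move=> pos eq1 cE; apply/(linear_relation_fold fold_inj_large cE) => i.
by rewrite !eq1.
Qed.

(** A relation on a smaller dependent set lifts to weights covering evenly; these are proportional
    to [lam], hence nowhere zero, so the set was not smaller. *)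
Lemma circuit_fold : resonance_circuit R (fold @: Phi).
Proof.
have [bal _] := minimal_balancedP _ _ mbPhi.
have [lam pos eq1] := (balancedP _ _).1 bal.
have Phi0 := minimal_balanced_set0 (ltn0Sn n) mbPhi.
apply/andP; split.
  (* Only [set0] and the full set fold to [set0]; the full set alone is already a complementary
     pair. *)
  apply/subsetP=> A /imsetP[S PhiS ->]; rewrite inE; apply/negP=> /eqP S0.
  case: (@large_not_sub_pair (fold S)); apply/subsetP=> T.
  case/complementary_pairP=> T0 eqTS.
  have [-> //|defT] := fold_eq (esym eqTS).
  have set00 : fold set0 = set0 by apply/setP=> j; rewrite !inE.
  have /fold_eq[S0'|TC] : fold S = fold set0 by rewrite S0 set00.
    by move: Phi0; rewrite S0' PhiS.
  by move: T0; rewrite defT -TC eqxx.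
have [c cE] := inj_in_section 0 (fun S => fold_sign S * lam S) fold_inj_large.
have [S PhiS _] := balanced_cover ord0 bal.
apply/minsetP; split.
  apply/lin_dependentP; exists c; first exact: large_relation pos eq1 cE.
  exists (fold S); first exact: imset_f.
  by rewrite cE// mulf_neq0 ?fold_sign_neq0// gt_eqF ?pos.
move=> C /lin_dependentP[d rel [A CA dA]] sub; apply/eqP; rewrite eqEsubset sub.
(* Extension by zero makes [d] a relation on all of [fold @: Phi]. *)
pose d' A := if A \in C then d A else 0.
pose mu S := fold_sign S * d' (fold S).
have dE : {in Phi, forall S, d' (fold S) = fold_sign S * mu S}.
  by move=> T _; rewrite /mu mulrA fold_signK mul1r.
have rel' : linear_relation (fold @: Phi) d'.
  move=> j; rewrite -[RHS](rel j) -(big_setIsub _ sub); apply: eq_bigr => B _.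
  by rewrite /d'; case: ifP => // _; rewrite mul0r.
have mu_const := (linear_relation_fold fold_inj_large dE).1 rel'.
have [s muE] :=
  minimal_balanced_weights_unique (ltn0Sn n) mbPhi pos eq1 mu_const.
have s_neq0 : s != 0.
  have /imsetP[T PhiT defA] := subsetP sub _ CA.
  apply: contraNneq dA => s0; have := dE T PhiT.
  by rewrite muE// s0 mul0r mulr0 -defA /d' CA => ->.
apply/subsetP=> _ /imsetP[T PhiT ->]; have := dE T PhiT; rewrite muE// /d'.
case: ifP => // _ /esym/eqP; rewrite !mulf_eq0 (negbTE (fold_sign_neq0 _)).
by rewrite (negbTE s_neq0) gt_eqF ?pos.
Qed.

End Large.

(** * From circuits back to minimal balanced collections *)

Definition unfold_circuit c C : {set {set 'I_n.+1}} :=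
  [set unfold (0 < c A) A | A in C].

Lemma fold_unfold_circuit c C : fold @: unfold_circuit c C = C.
Proof.
rewrite -imset_comp -[RHS]imset_id; apply: eq_imset => A /=.
exact: unfoldK.
Qed.

Lemma fold_inj_unfold_circuit c C : {in unfold_circuit c C &, injective fold}.
Proof.
by move=> _ _ /imsetP[A _ ->] /imsetP[B _ ->]; rewrite !unfoldK => ->.
Qed.

(** Folding recovers [A], and membership of [ord0] then reveals the sign of its coefficient. *)
Lemma unfold_circuit_neqN c C A :
  A \in C -> c A != 0 -> unfold_circuit c C != unfold_circuit (fun B => - c B) C.
Proof.
move=> CA cA; apply/eqP=> /setP/(_ (unfold (0 < c A) A)).
rewrite (imset_f (fun B => unfold (0 < c B) B)) // => /esym/imsetP[B _ eqAB].
have := congr1 fold eqAB; rewrite !unfoldK => defB; subst B.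
have := congr1 (fun S => ord0 \in S) eqAB; rewrite !unfold0 oppr_gt0.
by move: cA; case: ltgtP.
Qed.

(** The absolute values of [c] cover all points evenly. A balanced subcollection folds to a
    dependent subset of the circuit, hence to all of it. *)
Lemma minimal_balanced_unfold_circuit c C :
  resonance_circuit R C -> linear_relation C c ->
  {in C, forall A, c A != 0} -> minimal_balanced R (unfold_circuit c C).
Proof.
move=> circ rel c_neq0; set Phi := unfold_circuit c C.
have inj := @fold_inj_unfold_circuit c C.
have foldPhi : fold @: Phi = C by exact: fold_unfold_circuit.
pose mu S : R := `|c (fold S)|.
have muE : {in Phi, forall S, c (fold S) = fold_sign S * mu S}.
  move=> _ /imsetP[A CA ->]; rewrite /mu unfoldK /fold_sign unfold0.
  case: ltgtP (c_neq0 A CA) => // [c_gt0|c_lt0] _.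
    by rewrite mul1r gtr0_norm.
  by rewrite mulN1r ltr0_norm ?opprK.
have mu_gt0 : {in Phi, forall S, 0 < mu S}.
  by move=> _ /imsetP[A CA ->]; rewrite /mu unfoldK normr_gt0 c_neq0.
have mu_const : forall i, cover_weight Phi mu i = cover_weight Phi mu ord0.
  by apply/(linear_relation_fold inj muE); rewrite foldPhi.
have Phi_nz : exists2 S, S \in Phi & S != set0.
  have [? _ [A CA _]] := circuit_relation circ.
  exists (unfold (0 < c A) A); first exact: imset_f.
  case/andP: circ => /subsetP/(_ _ CA); rewrite inE => A0 _.
  apply: contraNneq A0 => eq0; rewrite -(unfoldK (0 < c A) A) eq0.
  by apply/eqP/setP=> j; rewrite !inE.
have term_ge0 i S : S \in Phi -> 0 <= mu S * (i \in S)%:R.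
  by move=> PhiS; rewrite mulr_ge0 ?ler0n// ltW ?mu_gt0.
(* The common cover is positive since some member is nonempty; it can thus be normalised to 1. *)
have k_gt0 : 0 < cover_weight Phi mu ord0.
  have [S PhiS /set0Pn[i Si]] := Phi_nz.
  rewrite -(mu_const i) /cover_weight (big_setD1 S)//= Si mulr1.
  apply: ltr_wpDr; last exact: mu_gt0.
  by apply: sumr_ge0 => T /setD1P[_]; exact: term_ge0.
apply/minimal_balancedP; split.
  have -> : Phi = [set S in Phi | 0 < mu S].
    apply/setP=> S; rewrite inE.
    by case: (boolP (S \in Phi)) => // /mu_gt0 ->.
  apply: balanced_support k_gt0 mu_const => S PhiS.
  by rewrite ltW ?mu_gt0.
move=> Psi balPsi sub.
have injPsi : {in Psi &, injective fold}.
  by move=> S T /(subsetP sub) PhiS /(subsetP sub) PhiT; exact: inj.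
have [lam pos eq1] := (balancedP _ _).1 balPsi.
have [d dE] := inj_in_section 0 (fun S => fold_sign S * lam S) injPsi.
have depPsi : lin_dependent R (fold @: Psi).
  apply/lin_dependentP; exists d.
    by apply/(linear_relation_fold injPsi dE) => i; rewrite !eq1.
  have [S PsiS _] := balanced_cover ord0 balPsi.
  exists (fold S); first exact: imset_f.
  by rewrite dE// mulf_neq0 ?fold_sign_neq0// gt_eqF ?pos.
case/andP: circ => _ /minsetP[_ /(_ _ depPsi)].
rewrite -foldPhi => /(_ (imsetS _ sub)) eq_img.
apply/eqP; rewrite eqEcard sub -(card_in_imset inj) -(card_in_imset injPsi).
by rewrite eq_img leqnn.
Qed.

(** The signed covering weights of [Phi] form a relation on [C], hence equal [s * c]; the sign of
    [s] selects the alternative. *)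
Lemma large_unfold_circuit Phi c C :
  minimal_balanced R Phi -> (3 <= #|Phi|)%N -> fold @: Phi = C ->
  linear_relation C c -> {in C, forall A, c A != 0} ->
  Phi = unfold_circuit c C \/ Phi = unfold_circuit (fun A => - c A) C.
Proof.
move=> mbPhi card_ge3 defC rel c_neq0.
have circ := circuit_fold mbPhi card_ge3.
have inj := fold_inj_large mbPhi card_ge3.
have [/balancedP[lam pos eq1] _] := minimal_balancedP _ _ mbPhi.
have [d dE] := inj_in_section 0 (fun S => fold_sign S * lam S) inj.
have reld := large_relation mbPhi card_ge3 pos eq1 dE.
rewrite defC in circ reld.
have [s dsE] := circuit_relation_unique circ rel c_neq0 reld.
have PhiE e : {in Phi, forall S, (0 < e (fold S)) = (ord0 \notin S)} ->
    Phi = unfold_circuit e C.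
  move=> eE; rewrite -defC /unfold_circuit -imset_comp -[LHS]imset_id.
  by apply: eq_in_imset => S PhiS /=; rewrite eE// foldK.
have d_gt0 : {in Phi, forall S, (0 < d (fold S)) = (ord0 \notin S)}.
  move=> S PhiS; rewrite dE// pmulr_lgt0 ?pos// /fold_sign.
  by case: (ord0 \in S); rewrite ?expr1 ?expr0 ?ltr01// oppr_gt0 ltr10.
have foldC S : S \in Phi -> fold S \in C by move=> PhiS; rewrite -defC imset_f.
case: (ltgtP s 0) => [s_lt0|s_gt0|s0].
- right; apply: PhiE => S PhiS; rewrite -d_gt0// dsE ?foldC//.
  by rewrite nmulr_rgt0// oppr_gt0.
- left; apply: PhiE => S PhiS; rewrite -d_gt0// dsE ?foldC//.
  by rewrite pmulr_rgt0.
- have [? _ [A CA _]] := circuit_relation circ.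
  move: CA; rewrite -defC => /imsetP[S PhiS _].
  have := dE S PhiS; rewrite dsE ?foldC// s0 mul0r => /esym/eqP.
  by rewrite mulf_eq0 (negbTE (fold_sign_neq0 _)) gt_eqF ?pos.
Qed.

(** * Counting *)

(** Folding is two-to-one and preserves size. The predicate [P] covers both a fixed size [m] and all
    sizes from 3 on. *)
Lemma card_large_minimal_balanced (P : pred nat) :
  (forall m, P m -> (3 <= m)%N) ->
  #|[set Phi : {set {set 'I_n.+1}} | minimal_balanced R Phi & P #|Phi|]| =
  (2 * #|[set C : {set {set 'I_n}} | resonance_circuit R C & P #|C|]|)%N.
Proof.
move=> P_ge3; set MB := [set Phi | _ & _]; set CC := [set C | _ & _].
have foldMB Phi : Phi \in MB -> [set fold S | S in Phi] \in CC.
  rewrite !inE => /andP[mb PPhi]; rewrite circuit_fold ?P_ge3//=.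
  by rewrite card_in_imset//; exact: fold_inj_large (P_ge3 _ PPhi).
rewrite -sum1_card (partition_big (fun Phi => fold @: Phi) (mem CC))//=.
rewrite mulnC -sum_nat_const; apply: eq_bigr => C.
rewrite inE => /andP[circ PC].
have [c rel c_neq0] := circuit_relation_nonzero circ.
have [? _ [A CA _]] := circuit_relation circ.
have relN : linear_relation C (fun A => - c A).
  by move=> j; under eq_bigr do rewrite mulNr; rewrite sumrN rel oppr0.
have cN_neq0 : {in C, forall A, - c A != 0}.
  by move=> B CB; rewrite oppr_eq0 c_neq0.
have unfoldMB e : minimal_balanced R (unfold_circuit e C) ->
    (unfold_circuit e C \in MB) && (fold @: unfold_circuit e C == C).
  move=> mb; rewrite fold_unfold_circuit eqxx andbT inE mb /=.
  rewrite -(card_in_imset (@fold_inj_unfold_circuit e C)).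
  by rewrite fold_unfold_circuit.
rewrite sum1_card.
have <- : #|[set unfold_circuit c C; unfold_circuit (fun A => - c A) C]| = 2%N.
  by rewrite cards2 (unfold_circuit_neqN CA (c_neq0 _ CA)).
apply: eq_card => Phi; rewrite [RHS]inE !in_set1 unfold_in.
apply/andP/orP=> [[]|].
  rewrite inE => /andP[mb PPhi] /eqP defC.
  have [->|->] := large_unfold_circuit mb (P_ge3 _ PPhi) defC rel c_neq0.
    by left.
  by right.
by case=> /eqP ->; apply/andP; apply: unfoldMB;
  exact: minimal_balanced_unfold_circuit.
Qed.

End Weights.
End Folding.

Theorem propositionD1 (R : realType) :
  (forall n m : nat, (1 <= n)%N -> (3 <= m <= n + 1)%N ->
     num_minimal_balanced_size R (n + 1)%N m = (2 * num_circuits_size R n m)%N)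
  /\
  (forall n : nat, (1 <= n)%N ->
     num_minimal_balanced R (n + 1)%N = (2 ^ n + 2 * num_circuits R n)%N).
Proof.
split=> [n m _ /andP[m_ge3 _]|n _]; rewrite addn1.
  by apply: (@card_large_minimal_balanced n R (pred1 m)) => _ /eqP ->.
have -> : num_circuits R n =
    #|[set C : {set {set 'I_n}} | resonance_circuit R C & (3 <= #|C|)%N]|.
  apply: eq_card => C; rewrite !inE.
  by case: (boolP (resonance_circuit R C)) => // /circuit_card_ge3 ->.
rewrite -(@card_large_minimal_balanced n R (leq 3))//.
rewrite -(card_small_minimal_balanced n R) /num_minimal_balanced.
(* Collections with at most two members give the term [2 ^ n], the others twice the number of
   circuits. *)
rewrite -(cardsID [set Phi : {set {set 'I_n.+1}} | #|Phi| <= 2]%N).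
congr (_ + _)%N; apply: eq_card => Phi; rewrite !inE//.
by rewrite -ltnNge andbC.
Qed.
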